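(* Let $G$ be a finite abelian group of order $n$, let $A\subset G$, and let $1\le k<n$. Then $$\mu_{k-1}(X_{A,k}) \geq |A| - k\max\{|\widehat{1_A}(\eta)| : \eta\in\widehat{G}_+\}.$$
   Context: $\widehat{G}$ is the character group of $G$, $\chi_0$ the trivial character, and $\widehat{G}_+=\widehat{G}\setminus\{\chi_0\}$. For a function $\phi:G\to\mathbb{C}$, its Fourier transform is $\widehat{\phi}(\chi)=\sum_{x\in G}\phi(x)\chi(-x)$ for $\chi\in\widehat G$; $1_A$ is the indicator function of $A$, so $\widehat{1_A}(\eta)=\sum_{a\in A}\eta(-a)$. Let $\Delta_{n-1}$ be the $(n-1)$-simplex on the vertex set $G$. The sum complex $X_{A,k}$ is the simplicial complex consisting of the full $(k-1)$-skeleton of $\Delta_{n-1}$ together with all $(k+1)$-subsets $\sigma\subset G$ with $\sum_{x\in\sigma}x\in A$. For a finite simplicial complex $X$ and $j\ge0$, let $X(j)$ be the set of $j$-simplices with fixed orientations; $C^j(X)$ is the space of complex-valued skew-symmetric functions on ordered $j$-simplices, with inner product $(\phi,\psi)_X=\sum_{\sigma\in X(j)}\phi(\sigma)\overline{\psi(\sigma)}$; $C^{-1}(X)=\mathbb{C}$. The coboundary is $d_j\phi([v_0,\dots,v_{j+1}])=\sum_{i=0}^{j+1}(-1)^i\phi([v_0,\dots,\widehat{v_i},\dots,v_{j+1}])$ for $j\ge0$ and $d_{-1}(a)(v)=a$; $d_j^*$ is its adjoint. The reduced Laplacian is $L_j(X)=d_{j-1}d_{j-1}^*+d_j^*d_j$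 on $C^j(X)$ and $\mu_j(X)$ is its minimal eigenvalue. *)

(* Defs.v *)
From HB Require Import structures.
From mathcomp Require Import boolp classical_sets reals complex.
From mathcomp Require Import all_boot all_order all_algebra all_fingroup.
Set Implicit Arguments.
Unset Strict Implicit.
Unset Printing Implicit Defensive.
Import Order.TTheory GRing.Theory Num.Theory.
Local Open Scope ring_scope.

(* The definitions are over a numClosedFieldType C, to be instantiated with
   R[i] for R : realType.  The order of C is partial: x <= y means that y - x
   is a nonnegative real number. *)

Section Extrema.
Variable C : numClosedFieldType.

(* The default value 0 is only used when S has no minimum (maximum). *)
Definition minimum (S : set C) : C :=
  xget 0 (fun m => S m /\ forall x, S x -> m <= x).
Definition maximum (S : set C) : C :=
  xget 0 (fun m => S m /\ forall x, S x -> x <= m).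

End Extrema.

Section Characters.
Variables (C : numClosedFieldType) (G : finZmodType).

(* A homomorphism from G to the multiplicative group of C; chi 0 = 1 forces
   the values to be nonzero. *)
Definition is_character (chi : G -> C) : Prop :=
  chi 0 = 1 /\ {morph chi : x y / x + y >-> x * y}.

Definition trivial_character : G -> C := fun=> 1.

Definition nontrivial_character (chi : G -> C) : Prop :=
  is_character chi /\ chi <> trivial_character.

Definition fourier (phi chi : G -> C) : C := \sum_(x : G) phi x * chi (- x).

Definition indicator (A : {set G}) : G -> C := fun x => (x \in A)%:R.

End Characters.

Record simplicial_complex (T : finType) := SimplicialComplex {
  faces :> {set {set T}};
  faces_set0 : set0 \in faces;
  faces_subset : forall s t : {set T}, s \in faces -> t \subset s -> t \in faces
}.

Section TupleOps.
Variable T : finType.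

Definition perm_tuple m (s : 'S_m) (t : m.-tuple T) : m.-tuple T :=
  [tuple tnth t (s i) | i < m].

Definition drop_vertex m (t : m.+1.-tuple T) (i : 'I_m.+1) : m.-tuple T :=
  [tuple tnth t (lift i j) | j < m].

End TupleOps.

Section Cochains.
Variables (C : numClosedFieldType) (T : finType) (X : simplicial_complex T).

(* Everything is indexed by the number m of vertices, so that m corresponds to
   dimension m - 1 and the empty tuple is the simplex of dimension -1. *)
Definition ordered_simplex m (t : m.-tuple T) : bool :=
  uniq t && ([set x in t] \in faces X).

Local Notation fun_space m := {ffun m.-tuple T -> C^o}.

Definition skew_defect m (f : fun_space m) : {ffun 'S_m * m.-tuple T -> C^o} :=
  [ffun st => f (perm_tuple st.1 st.2) - (-1) ^+ st.1 * f st.2].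

Definition off_simplices m (f : fun_space m) : fun_space m :=
  [ffun t => if ordered_simplex t then 0 else f t].

Fact skew_defect_linear m : linear (@skew_defect m).
Proof.
move=> a f g; apply/ffunP=> st; rewrite !ffunE /GRing.scale /=.
by rewrite mulrDr mulrBr opprD addrACA mulrCA.
Qed.
HB.instance Definition _ m := GRing.isLinear.Build C _ _ _
  (@skew_defect m) (@skew_defect_linear m).

Fact off_simplices_linear m : linear (@off_simplices m).
Proof.
move=> a f g; apply/ffunP=> t; rewrite !ffunE.
by case: ifP => // _; rewrite scaler0 addr0.
Qed.
HB.instance Definition _ m := GRing.isLinear.Build C _ _ _
  (@off_simplices m) (@off_simplices_linear m).

(* C^(m-1)(X): a function on ordered simplices is extended by zero to all
   m-tuples of vertices; see cochain_spaceP. *)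
Definition cochain_space m : {vspace fun_space m} :=
  (lker (linfun (@skew_defect m)) :&: lker (linfun (@off_simplices m)))%VS.

Lemma cochain_spaceP m (f : fun_space m) :
  f \in cochain_space m <->
  (forall (s : 'S_m) t, f (perm_tuple s t) = (-1) ^+ s * f t) /\
  (forall t, ~~ ordered_simplex t -> f t = 0).
Proof.
rewrite memv_cap !memv_ker !lfunE /=; split.
  case/andP=> /eqP/ffunP f1 /eqP/ffunP f2; split=> [s t|t tX].
    by apply/eqP; rewrite -subr_eq0; have := f1 (s, t); rewrite !ffunE => ->.
  by have := f2 t; rewrite !ffunE (negbTE tX).
case=> f1 f2; apply/andP; split; apply/eqP/ffunP=> st; rewrite !ffunE.
  by rewrite f1 subrr.
by case: ifPn => // /f2.
Qed.

Definition cochain m := subvs_of (cochain_space m).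

Definition coboundary_fun m (f : fun_space m) : fun_space m.+1 :=
  [ffun t => if ordered_simplex t
             then \sum_(i < m.+1) (-1) ^+ i * f (drop_vertex t i) else 0].

Fact coboundary_fun_linear m : linear (@coboundary_fun m).
Proof.
move=> a f g; apply/ffunP=> t; rewrite !ffunE.
case: ifP => _; last by rewrite scaler0 addr0.
rewrite scaler_sumr -big_split; apply: eq_bigr => i _ /=.
by rewrite !ffunE /GRing.scale /= mulrDr mulrCA.
Qed.
HB.instance Definition _ m := GRing.isLinear.Build C _ _ _
  (@coboundary_fun m) (@coboundary_fun_linear m).

Lemma mem_perm_tuple m (s : 'S_m) (t : m.-tuple T) : perm_tuple s t =i t.
Proof.
move=> x; apply/tnthP/tnthP=> -[i ->]; first by exists (s i); rewrite tnth_mktuple.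
by exists (s^-1%g i); rewrite tnth_mktuple permKV.
Qed.

Lemma ordered_simplex_perm m (s : 'S_m) (t : m.-tuple T) :
  ordered_simplex (perm_tuple s t) = ordered_simplex t.
Proof.
have e := mem_perm_tuple s t; rewrite /ordered_simplex.
rewrite (@eq_uniq _ (perm_tuple s t) t) ?size_tuple //.
suff -> : [set x in perm_tuple s t] = [set x in t] by [].
by apply/finset.setP=> x; rewrite !inE e.
Qed.

Lemma lift_perm_factor m (s : 'S_m.+1) (i : 'I_m.+1) :
  exists r : 'S_m, s = lift_perm i (s i) r.
Proof.
have ne j : s i != s (lift i j) by rewrite (inj_eq perm_inj) neq_lift.
pose g j := odflt j (unlift (s i) (s (lift i j))).
have gE j : s (lift i j) = lift (s i) (g j).
  by rewrite /g; case: unliftP (ne j) => [k ->|->] //; rewrite eqxx.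
have g_inj : injective g.
  move=> j k ejk; apply: (@lift_inj _ i); apply: (@perm_inj _ s).
  by rewrite !gE ejk.
exists (perm g_inj); apply/permP=> j.
case: (unliftP i j) => [k ->|->]; last by rewrite lift_perm_id.
by rewrite lift_perm_lift permE gE.
Qed.

Lemma drop_vertex_perm m (i j : 'I_m.+1) (r : 'S_m) (t : m.+1.-tuple T) :
  drop_vertex (perm_tuple (lift_perm i j r) t) i = perm_tuple r (drop_vertex t j).
Proof. by apply: eq_from_tnth => l; rewrite !tnth_mktuple lift_perm_lift. Qed.

Lemma coboundary_fun_mem m (f : fun_space m) :
  f \in cochain_space m -> coboundary_fun f \in cochain_space m.+1.
Proof.
case/cochain_spaceP=> fs _; apply/cochain_spaceP; split=> [s t|t]; last first.
  by rewrite ffunE => /negbTE ->.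
rewrite !ffunE ordered_simplex_perm; case: ifP => _; last by rewrite mulr0.
rewrite big_distrr [RHS](reindex_inj (@perm_inj _ s)) /=.
apply: eq_bigr => i _; have [r sE] := lift_perm_factor s i.
rewrite {1}sE drop_vertex_perm fs sE odd_lift_perm lift_perm_id !mulrA.
congr (_ * _); rewrite !signr_addb (signr_odd _ i) (signr_odd _ (s i)).
by rewrite [RHS]mulrAC -(mulrA ((-1) ^+ i)) -expr2 sqrr_sign mulr1.
Qed.

(* By coboundary_fun_mem, vsproj only changes the type here. *)
Definition coboundary m : 'Hom(cochain m, cochain m.+1) :=
  linfun (vsproj (cochain_space m.+1) \o @coboundary_fun m \o vsval).

Lemma coboundaryE m (f : cochain m) :
  vsval (coboundary m f) = coboundary_fun (vsval f).
Proof. by rewrite lfunE /= vsprojK // coboundary_fun_mem // subvsP. Qed.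

(* The fixed orientation of a simplex lists its vertices in the order of the
   enumeration of T. *)
Definition oriented_simplex m (t : m.-tuple T) : bool :=
  ordered_simplex t && (tval t == enum t).

Definition inner m (f g : cochain m) : C :=
  \sum_(t : m.-tuple T | oriented_simplex t) vsval f t * (vsval g t)^*.

Lemma inner_linearl m a (f g h : cochain m) :
  inner (a *: f + g) h = a * inner f h + inner g h.
Proof.
rewrite /inner big_distrr -big_split; apply: eq_bigr => t _ /=.
by rewrite !ffunE /GRing.scale /= mulrDl mulrA.
Qed.

Lemma inner_conj m (f g : cochain m) : (inner f g)^* = inner g f.
Proof.
by rewrite rmorph_sum; apply: eq_bigr => t _; rewrite rmorphM /= conjCK mulrC.
Qed.

Lemma inner_suml m (I : finType) (a : I -> C) (F : I -> cochain m) h :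
  inner (\sum_i a i *: F i) h = \sum_i a i * inner (F i) h.
Proof.
elim/big_rec2: _ => [|i x y _ <-]; last by rewrite inner_linearl.
by rewrite /inner big1 // => t _; rewrite ffunE mul0r.
Qed.

Lemma inner_sumr m (I : finType) (a : I -> C) (F : I -> cochain m) h :
  inner h (\sum_i a i *: F i) = \sum_i (a i)^* * inner h (F i).
Proof.
rewrite -inner_conj inner_suml rmorph_sum; apply: eq_bigr => i _.
by rewrite rmorphM /= inner_conj.
Qed.

Lemma inner_eq0 m (f : cochain m) : inner f f = 0 -> f = 0.
Proof.
move=> f0; apply: val_inj; apply/ffunP=> t; rewrite [RHS]ffunE.
have [fs fX] := (cochain_spaceP (vsval f)).1 (subvsP f).
case tX: (ordered_simplex t); last by rewrite fX ?tX.
have et : size (enum t) == m.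
  by rewrite -cardE; case/andP: (tX) => /card_uniqP -> _; rewrite size_tuple.
pose o := Tuple et; have [ut _] := andP tX.
have [s sE] : exists s : 'S_m, t = perm_tuple s o.
  have /tuple_permP[s sE] : perm_eq t o.
    by apply: uniq_perm => //; [exact: enum_uniq | move=> x; rewrite mem_enum].
  by exists s; apply: val_inj.
have oX : ordered_simplex o by rewrite -(ordered_simplex_perm s) -sE.
rewrite sE fs; have -> : vsval f o = 0; last by rewrite mulr0.
have oO : oriented_simplex o.
  rewrite /oriented_simplex oX /=; apply/eqP/eq_enum => x.
  by rewrite [RHS]mem_enum.
apply/eqP; rewrite -normr_eq0 -sqrf_eq0 normCK; apply/eqP.
by apply: (psumr_eq0P _ f0) => // u _; rewrite mul_conjC_ge0.
Qed.

Lemma inner_inj m (g h : cochain m) :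
  (forall f, inner f g = inner f h) -> g = h.
Proof.
move=> gh; apply/eqP; rewrite -subr_eq0; apply/eqP/inner_eq0.
have bl f : inner f (g - h) = inner f g - inner f h.
  by rewrite -inner_conj addrC -scaleN1r inner_linearl !(rmorphD, rmorphM) /=
    rmorphN1 !inner_conj mulN1r addrC.
by rewrite bl gh subrr.
Qed.

Lemma inner_riesz m (l : {linear cochain m -> C^o}) :
  exists h, forall f, inner f h = l f.
Proof.
set b := vbasis {: cochain m}.
pose Gr := \matrix_(i, j) inner b`_i b`_j : 'M[C]_(\dim {: cochain m}).
have Gu : Gr \in unitmx.
  rewrite unitmxE unitfE; apply/det0P=> -[v /eqP v0 vG]; apply: v0.
  have w0 : \sum_i v 0 i *: b`_i = 0.
    apply: inner_eq0; rewrite inner_sumr big1 // => j _; rewrite inner_suml.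
    move/matrixP: vG => /(_ 0 j); rewrite !mxE => e.
    rewrite (_ : \sum_i _ = 0) ?mulr0 // -[RHS]e.
    by apply: eq_bigr => i _; rewrite mxE.
  have /freeP fb : free b by apply: basis_free (vbasisP _).
  by apply/rowP=> i; rewrite mxE (fb (v 0) w0).
pose c := invmx Gr *m (\col_i l b`_i).
exists (\sum_i (c i 0)^* *: b`_i) => f.
rewrite (coord_vbasis (memvf f)) inner_suml linear_sum; apply: eq_bigr => i _.
rewrite linearZ /= inner_sumr; congr (_ * _).
have := mulKVmx Gu (\col_i l b`_i) => /matrixP/(_ i 0).
rewrite !mxE => <-; apply: eq_bigr => j _.
by rewrite conjCK [in RHS]mxE mulrC.
Qed.

Definition is_adjoint m p (u : 'Hom(cochain m, cochain p))
    (v : 'Hom(cochain p, cochain m)) : Prop :=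
  forall f g, inner (u f) g = inner f (v g).

(* An adjoint exists and is unique, see adjointP and adjoint_unique. *)
Definition adjoint m p (u : 'Hom(cochain m, cochain p)) :
    'Hom(cochain p, cochain m) := xget 0 (is_adjoint u).

Lemma adjointP m p (u : 'Hom(cochain m, cochain p)) :
  is_adjoint u (adjoint u).
Proof.
apply: xgetPex.
have ex g : exists h, forall f, inner (u f) g = inner f h.
  pose l f : C^o := inner (u f) g.
  have lin : linear l by move=> a f h; rewrite /l linearP inner_linearl.
  pose L : {linear cochain m -> C^o} :=
    HB.pack l (GRing.isLinear.Build C _ _ _ l lin).
  by have [h hE] := inner_riesz L; exists h => f; rewrite hE.
have [v vE] := choice ex.
have lin : linear v.
  move=> a g h; apply: inner_inj => f; rewrite -vE.
  rewrite -inner_conj inner_linearl rmorphD rmorphM /= !inner_conj !vE.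
  by rewrite -[RHS]inner_conj inner_linearl rmorphD rmorphM /= !inner_conj.
pose V : {linear cochain p -> cochain m} :=
  HB.pack v (GRing.isLinear.Build C _ _ _ v lin).
by exists (linfun V) => f g; rewrite lfunE vE.
Qed.

Lemma adjoint_unique m p (u : 'Hom(cochain m, cochain p)) v :
  is_adjoint u v -> v = adjoint u.
Proof.
move=> uv; apply/lfunP=> g; apply: inner_inj => f.
by rewrite -uv -adjointP.
Qed.

(* The reduced Laplacian L_j(X), an endomorphism of C^j(X); here
   coboundary j = d_(j-1). *)
Definition laplacian j : 'End(cochain j.+1) :=
  ((coboundary j \o adjoint (coboundary j))
   + (adjoint (coboundary j.+1) \o coboundary j.+1))%VF.

Definition min_eigenvalue_laplacian j : C :=
  minimum (fun a => passmx.leigenvalue (laplacian j) a).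

End Cochains.

Section SumComplex.
Variables (G : finZmodType) (A : {set G}) (k : nat).

Definition sum_complex_faces : {set {set G}} :=
  [set s : {set G} | (#|s| <= k)%N
                     || (#|s| == k.+1) && (\sum_(x in s) x \in A)].

Fact sum_complex_set0 : finset.set0 \in sum_complex_faces.
Proof. by rewrite inE cards0. Qed.

Fact sum_complex_subset (s t : {set G}) :
  s \in sum_complex_faces -> t \subset s -> t \in sum_complex_faces.
Proof.
rewrite !inE => sX ts; have [-> //|nst] := eqVneq t s.
have lt_ts : (#|t| < #|s|)%N by apply: proper_card; rewrite properEneq nst.
apply/orP; left; case/orP: sX => [|/andP[/eqP sk _]].
  by apply: leq_trans; exact: ltnW.
by rewrite -ltnS -sk.
Qed.

Definition sum_complex : simplicial_complex G :=
  SimplicialComplex sum_complex_set0 sum_complex_subset.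

End SumComplex.

(* Main.v *)
(* Let phi be an eigencochain for the eigenvalue a, regarded as a skew function
   on all k-tuples of G, and S = sum |phi|^2.  The adjoint of the coboundary is
   the fibre sum (d* phi)(w) = sum_u phi(u, w), and expanding <L phi, phi> gives
     a S = |A| S - k sum_w (Q_w - |sum_u phi(u, w)|^2),
     Q_w = sum_(u, v) 1_A(u + v + sum w) phi(u, w) phi(v, w)^*,
   where w ranges over the (k-1)-tuples.  Expanding 1_A in characters, the
   trivial one contributes (|A| / n) |sum_u phi(u, w)|^2 <= |sum_u phi(u, w)|^2
   to Q_w, and by Parseval the others contribute at most
   (max |1_A^|) sum_u |phi(u, w)|^2. *)

Require Import Defs.
From mathcomp Require Import boolp classical_sets reals complex.
From mathcomp Require Import all_boot all_order all_algebra all_fingroup.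
From mathcomp Require Import ring.
Set Implicit Arguments.
Unset Strict Implicit.
Unset Printing Implicit Defensive.
Import Order.TTheory GRing.Theory Num.Theory.
Local Open Scope ring_scope.

(** * Orthogonality and completeness of the characters of a finite abelian group *)

Section CharacterTheory.
Variables (C : numClosedFieldType) (G : finZmodType).
Implicit Types (chi psi : G -> C) (x y : G).

Lemma sum_shift (V : nmodType) (F : G -> V) (a : G) :
  \sum_x F (a + x) = \sum_x F x.
Proof. by rewrite [RHS](reindex_inj (addrI a)). Qed.

(** Translation by [x] preserves the positive sum [S] and multiplies it by the squared norm of
    [chi x]. *)
Lemma character_norm chi x : is_character chi -> `|chi x| = 1.
Proof.
case=> chi0 chiD; pose S := \sum_y `|chi y| ^+ 2.
have S_gt0 : 0 < S.
  rewrite /S (bigD1 0) //= chi0 normr1 expr1n ltr_wpDr ?ltr01 //.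
  by apply: sumr_ge0 => y _; rewrite exprn_ge0.
have e : `|chi x| ^+ 2 * S = 1 * S.
  rewrite mul1r -[RHS](sum_shift (fun y => `|chi y| ^+ 2) x) mulr_sumr.
  by apply: eq_bigr => y _; rewrite chiD normrM exprMn.
move/(mulIf (lt0r_neq0 S_gt0)): e => /eqP.
by rewrite sqrp_eq1 // => /eqP.
Qed.

Lemma characterN chi x : is_character chi -> chi (- x) = (chi x)^*.
Proof.
move=> chiP; have [chi0 chiD] := chiP.
have nz : chi x != 0 by rewrite -normr_eq0 character_norm // oner_eq0.
apply: (mulfI nz); rewrite -chiD subrr chi0 -normCK character_norm //.
by rewrite expr1n.
Qed.

(** At a point [a] where the characters differ, translation by [a] preserves the sum and multiplies
    it by a factor other than 1. *)
Lemma character_orthogonal chi psi :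
  is_character chi -> is_character psi -> chi <> psi ->
  \sum_x chi x * (psi x)^* = 0.
Proof.
move=> chiP psiP ne; have [_ chiD] := chiP; have [_ psiD] := psiP.
have [a ha] : exists a, chi a <> psi a.
  by apply: contra_notP ne => h; apply: funext => x; apply: contra_notP h; exists x.
set S := \sum_x _.
have e : chi a * (psi a)^* * S = S.
  rewrite -[RHS](sum_shift _ a) mulr_sumr; apply: eq_bigr => x _.
  by rewrite chiD psiD rmorphM /= mulrACA.
have : (chi a * (psi a)^* - 1) * S = 0 by rewrite mulrBl e mul1r subrr.
move/eqP; rewrite mulf_eq0 => /orP[|/eqP //].
rewrite subr_eq0 => /eqP e1; case: ha.
have nz : (psi a)^* != 0.
  by rewrite conjC_eq0 -normr_eq0 character_norm // oner_eq0.
by apply: (mulIf nz); rewrite e1 -normCK character_norm // expr1n.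
Qed.

Lemma character_sqnorm chi : is_character chi ->
  \sum_x chi x * (chi x)^* = #|G|%:R.
Proof.
move=> chiP; rewrite (eq_bigr (fun=> 1)) ?sumr_const // => x _.
by rewrite -normCK character_norm // expr1n.
Qed.

Let n := #|G|.
(** The regular representation on row vectors; its common eigenvectors will be the characters up to
    scale. *)
Definition translation (a : G) : 'M[C]_n :=
  \matrix_(i, j) (enum_val i == enum_val j + a)%:R.

Lemma sum_enum_rank (V : nmodType) (F : 'I_n -> V) :
  \sum_i F i = \sum_(x : G) F (enum_rank x).
Proof. by rewrite (reindex _ (onW_bij _ (@enum_rank_bij G))). Qed.

Lemma mul_translation m (M : 'M[C]_(m, n)) a i x :
  (M *m translation a) i (enum_rank x) = M i (enum_rank (x + a)).
Proof.
rewrite mxE sum_enum_rank (bigD1 (x + a)) //= mxE !enum_rankK eqxx mulr1.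
rewrite big1 ?addr0 // => y ne; rewrite mxE !enum_rankK (negbTE ne) mulr0 //.
Qed.

Lemma translation_comm a b : comm_mx (translation a) (translation b).
Proof.
apply/matrixP=> i j; rewrite -(enum_valK j) !mul_translation !mxE.
by rewrite !enum_rankK -!addrA (addrC a).
Qed.

Lemma translation_adjoint a : translation (- a) = ((translation a) ^t*)%sesqui.
Proof.
apply/matrixP=> i j; rewrite !mxE conjC_nat.
by rewrite -subr_eq opprK eq_sym.
Qed.

(* Translations commute and are closed under adjoints, so a unitary matrix
   that makes them all triangular makes them all diagonal. *)
Lemma translation_eigenbasis : exists (P : 'M[C]_n) (d : 'I_n -> G -> C),
  P \is unitarymx /\
  forall i x a, P i (enum_rank (x + a)) = d i a * P i (enum_rank x).
Proof.
have [|P Pu /allP /= Ptrig] := @cotrigonalization C n [seq translation a | a : G].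
  by move=> _ _ /mapP[a _ ->] /mapP[b _ ->]; apply: translation_comm.
have tri a (i j : 'I_n) : (i < j)%N -> (P *m translation a *m P^t*%sesqui) i j = 0.
  have aG : translation a \in [seq translation a | a : G] by apply: image_f.
  by rewrite -conjymx //; have /is_trig_mxP := Ptrig _ aG; apply.
have diag a (i j : 'I_n) : i != j -> (P *m translation a *m P^t*%sesqui) i j = 0.
  rewrite -val_eqE neq_ltn => /orP[/tri //|/(tri (- a))].
  rewrite translation_adjoint => eq0; apply/eqP; rewrite -conjC_eq0 -eq0.
  rewrite -[P as X in _ == (X *m _ *m _) _ _]trmxCK.
  by rewrite -!map_mxM -!trmx_mul mulmxA !mxE.
exists P, (fun i a => (P *m translation a *m P^t*%sesqui) i i); split=> // i x a.
rewrite -mul_translation -[in LHS](mulmxKtV (P *m translation a) Pu) // mxE (bigD1 i) //=.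
by rewrite big1 ?addr0 // => j ij; rewrite diag 1?eq_sym // mul0r.
Qed.

(** A common eigenvector of the translations is its value at 0 times its eigenvalue function, which
    is therefore a character. Unitarity by rows and by columns gives the two relations. *)
Lemma character_basis : exists chi : 'I_n -> G -> C,
  [/\ forall i, is_character (chi i),
      forall i j, \sum_x chi i x * (chi j x)^* = n%:R * (i == j)%:R &
      forall x y, \sum_i chi i x * (chi i y)^* = n%:R * (x == y)%:R].
Proof.
have [P [d [Pu dP]]] := translation_eigenbasis.
have PP i j : \sum_x P i (enum_rank x) * (P j (enum_rank x))^* = (i == j)%:R.
  have /unitarymxP/matrixP/(_ i j) := Pu.
  rewrite !mxE sum_enum_rank => <-.
  by apply: eq_bigr => x _; rewrite !mxE.
have tPP x y : \sum_i P i (enum_rank x) * (P i (enum_rank y))^* = (x == y)%:R.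
  have /unitarymxP/mulmx1C/matrixP/(_ (enum_rank y) (enum_rank x)) := Pu.
  rewrite !mxE (inj_eq enum_rank_inj) eq_sym => <-.
  by apply: eq_bigr => i _; rewrite !mxE mulrC.
pose c i := P i (enum_rank 0).
have PE i x : P i (enum_rank x) = d i x * c i by rewrite -dP add0r.
(* A row vanishing at 0 would vanish identically, against its norm being 1. *)
have c_neq0 i : c i != 0.
  apply: contra_eq_neq (PP i i) => ci0; rewrite eqxx big1 1?eq_sym ?oner_eq0 //.
  by move=> x _; rewrite PE ci0 mulr0 mul0r.
have dchar i : is_character (d i).
  split=> [|x y]; first by apply: (mulIf (c_neq0 i)); rewrite -PE mul1r.
  by apply: (mulIf (c_neq0 i)); rewrite -PE dP PE mulrA (mulrC (d i x)).
have n0 : n%:R != 0 :> C by rewrite pnatr_eq0 -lt0n; apply/card_gt0P; exists 0.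
have cc i : c i * (c i)^* = n%:R^-1.
  apply: (mulfI n0); rewrite mulfV // -(character_sqnorm (dchar i)).
  have <- : (i == i)%:R = 1 :> C by rewrite eqxx.
  rewrite -PP mulr_suml; apply: eq_bigr => x _.
  by rewrite !PE rmorphM /= mulrACA.
exists d; split=> // [i j|x y].
  have [<-|ij] := eqVneq i j; first by rewrite mulr1 character_sqnorm.
  rewrite mulr0; have : c i * (c j)^* != 0 by rewrite mulf_neq0 ?conjC_eq0.
  move/mulIf; apply; rewrite mul0r mulr_suml.
  transitivity ((i == j)%:R : C); last by rewrite (negbTE ij).
  by rewrite -PP; apply: eq_bigr => x _; rewrite !PE rmorphM /= mulrACA.
rewrite -tPP mulr_sumr; apply: eq_bigr => i _.
by rewrite !PE rmorphM /= mulrACA cc [RHS]mulrC mulfVK.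
Qed.

(** A character missing from the family would be orthogonal to all its members; completeness would
    then force [psi 0] to vanish. *)
Lemma character_basis_onto (chi : 'I_n -> G -> C) :
  (forall i, is_character (chi i)) ->
  (forall x y, \sum_i chi i x * (chi i y)^* = n%:R * (x == y)%:R) ->
  forall psi, is_character psi -> exists i, psi = chi i.
Proof.
move=> chiP dual psi psiP; apply: contrapT => nex.
have eq0 : \sum_i (\sum_x psi x * (chi i x)^*) * chi i 0 = 0.
  apply: big1 => i _; rewrite character_orthogonal ?mul0r // => e.
  by apply: nex; exists i.
move: eq0; under eq_bigr do rewrite mulr_suml.
rewrite exchange_big (bigD1 0) //= [X in _ + X]big1 => [|x x0].
  under eq_bigr do rewrite -mulrA (mulrC _^*).
  rewrite addr0 -mulr_sumr dual eqxx psiP.1 mul1r mulr1 => /eqP.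
  by apply/negP; rewrite pnatr_eq0 -lt0n; apply/card_gt0P; exists 0.
under eq_bigr do rewrite -mulrA (mulrC _^*).
by rewrite -mulr_sumr dual eq_sym (negbTE x0) !mulr0.
Qed.

End CharacterTheory.

(** * Minima and maxima of finite sets of real elements *)

Section Extrema.
Variable C : numClosedFieldType.
Local Open Scope classical_set_scope.

(** The relation is only required to be total on [S], so that both [<=] and [>=] on real elements of
    [C] qualify. *)
Lemma exists_extremum (T : eqType) (r : rel T) (S : set T) (s : seq T) :
  transitive r -> (forall x y, S x -> S y -> r x y || r y x) ->
  S !=set0 -> (forall x, S x -> x \in s) ->
  exists2 m, S m & forall x, S x -> r m x.
Proof.
move=> r_trans r_total [x0 Sx0] Ss.
have refl x : S x -> r x x by move=> Sx; have := r_total _ _ Sx Sx; rewrite orbb.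
have : [seq x <- s | `[< S x >]] != [::].
  apply/eqP => e; have : x0 \in [seq x <- s | `[< S x >]].
    by rewrite mem_filter Ss // andbT; apply/asboolP.
  by rewrite e.
have : forall x, x \in [seq x <- s | `[< S x >]] <-> S x.
  move=> x; rewrite mem_filter; split=> [/andP[/asboolP //]|Sx].
  by rewrite Ss // andbT; apply/asboolP.
move: [seq x <- s | _] => {Ss Sx0 x0} u.
elim: u S r_total refl => // a u IH S r_total refl uS _.
have Sa : S a by apply/uS; rewrite mem_head.
have [u0|u_neq0] := eqVneq u [::].
  by exists a => // x /uS; rewrite u0 inE => /eqP ->; apply: refl.
have SuS x : x \in u -> S x by move=> xu; apply/uS; rewrite inE xu orbT.
have [||m mu mP] := IH [set x | x \in u] _ _ (fun=> iff_refl _) u_neq0.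
- by move=> x y /SuS Sx /SuS Sy; apply: r_total.
- by move=> x /SuS; apply: refl.
have [am|ma] := orP (r_total a m Sa (SuS _ mu)).
  exists a => // x Sx; have := (uS x).2 Sx; rewrite inE => /orP[/eqP ->|xu].
    exact: refl.
  exact: r_trans am (mP _ xu).
exists m; first exact: SuS.
by move=> x /(uS x).2; rewrite inE => /orP[/eqP ->|/mP].
Qed.

Variables (S : set C) (s : seq C).
Hypotheses (S_neq0 : S !=set0) (Ss : forall x, S x -> x \in s).
Hypothesis S_real : forall x, S x -> x \is Num.real.

(** The default of [xget] is excluded, since a finite nonempty set of real elements has a
    minimum. *)
Lemma minimum_mem : S (minimum S).
Proof.
rewrite /minimum; case: xgetP => [m _ [] //|nex]; exfalso.
have [||m Sm mP] := @exists_extremum C <=%R S s _ _ S_neq0 Ss.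
- exact: le_trans.
- by move=> x y /S_real xR /S_real yR; apply: real_leVge.
- exact: (nex m).
Qed.

Lemma maximum_ub x : S x -> x <= maximum S.
Proof.
rewrite /maximum; case: xgetP => [m _ [_ /(_ x)] //|nex]; exfalso.
have [||m Sm mP] := @exists_extremum C >=%R S s _ _ S_neq0 Ss.
- exact: ge_trans.
- by move=> y z /S_real yR /S_real zR; rewrite orbC; apply: real_leVge.
- exact: (nex m).
Qed.

End Extrema.

(** * The Fourier estimate of the translated form *)

Section FourierBound.
Variables (C : numClosedFieldType) (G : finZmodType) (A : {set G}).

Definition nontrivial_spectrum : set C :=
  [set `|fourier (indicator C A) eta| | eta in @nontrivial_character C G]%classic.
Let M := maximum nontrivial_spectrum.
Hypothesis card_gt1 : (1 < #|G|)%N.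

Lemma nontrivial_fourier_le (eta : G -> C) :
  nontrivial_character eta -> `|fourier (indicator C A) eta| <= M.
Proof.
move=> etaP; have [chi [chiP orth dual]] := character_basis C G.
have chi_onto := character_basis_onto chiP dual.
apply: (@maximum_ub C _ [seq `|fourier (indicator C A) (chi i)| | i : 'I_#|G|]).
- by exists (`|fourier (indicator C A) eta|), eta.
- by move=> _ [psi [/chi_onto[i ->] _] <-]; apply: image_f.
- by move=> _ [psi _ <-]; apply: normr_real.
- by exists eta.
Qed.

(** Orthogonality of two members of the family shows that they are not all trivial, so [M] dominates
    at least one norm. *)
Lemma nontrivial_fourier_max_ge0 : 0 <= M.
Proof.
have [chi [chiP orth dual]] := character_basis C G.
pose i0 : 'I_#|G| := Ordinal (ltnW card_gt1); pose i1 : 'I_#|G| := Ordinal card_gt1.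
have [i ne] : exists i, chi i <> @trivial_character C G.
  apply: contrapT => nex; have triv i : chi i = @trivial_character C G.
    by apply: contra_notP nex => ne; exists i.
  have := orth i0 i1; rewrite (triv i1) -(triv i0) orth eqxx mulr1 mulr0 => /eqP.
  by rewrite pnatr_eq0 -leqn0 leqNgt (ltnW card_gt1).
apply: le_trans (nontrivial_fourier_le (conj (chiP i) ne)).
exact: normr_ge0.
Qed.

Variable f : G -> C.
Let F := \sum_x `|f x| ^+ 2.

(** Expanding the indicator separates [u], [v] and [s]. For nontrivial characters the product of the
    norms of [L i] and [R i] is at most half the sum of their squares, and Parseval applies to
    both. *)
Lemma translate_form_le (s : G) :
  \sum_u \sum_v indicator C A (u + v + s) * f u * (f v)^* - `|\sum_u f u| ^+ 2
    <= M * F.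
Proof.
have [chi [chiP orth dual]] := character_basis C G.
set n : C := #|G|%:R in orth dual *.
have n0 : 0 < n by rewrite ltr0n (ltnW card_gt1).
pose Ah i := fourier (indicator C A) (chi i).
(* As [v] enters [u + v + s] with a plus sign, the coefficients of [f] and of its conjugate are
   taken at the same character. *)
pose L i := \sum_u f u * chi i u; pose R i := \sum_v (f v)^* * chi i v.
pose Q := \sum_u \sum_v indicator C A (u + v + s) * f u * (f v)^*.
have inversion w : n * indicator C A w = \sum_i Ah i * chi i w.
  under [RHS]eq_bigr do rewrite mulr_suml.
  rewrite exchange_big (bigD1 w) //= [X in _ + X]big1 => [|x xw].
    under eq_bigr do rewrite (characterN _ (chiP _)) -mulrA (mulrC _^*).
    by rewrite -mulr_sumr dual eqxx mulr1 addr0 mulrC.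
  under eq_bigr do rewrite (characterN _ (chiP _)) -mulrA (mulrC _^*).
  by rewrite -mulr_sumr dual eq_sym (negbTE xw) !mulr0.
have parseval (g : G -> C) : \sum_i `|\sum_u g u * chi i u| ^+ 2 = n * \sum_u `|g u| ^+ 2.
  rewrite mulr_sumr.
  under eq_bigr => i _.
    rewrite normCK rmorph_sum mulr_suml.
    under eq_bigr => u _ do rewrite mulr_sumr.
    over.
  rewrite exchange_big; apply: eq_bigr => u _ /=.
  rewrite exchange_big (bigD1 u) //= [X in _ + X]big1 => [|v vu].
    under eq_bigr do rewrite rmorphM /= mulrACA.
    by rewrite -mulr_sumr dual eqxx mulr1 addr0 mulrC normCK.
  under eq_bigr do rewrite rmorphM /= mulrACA.
  by rewrite -mulr_sumr dual eq_sym (negbTE vu) !mulr0.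
have QE : n * Q = \sum_i Ah i * chi i s * (L i * R i).
  rewrite /Q mulr_sumr.
  under eq_bigr => u _.
    rewrite mulr_sumr.
    under eq_bigr => v _ do rewrite !mulrA inversion !mulr_suml.
    rewrite exchange_big. over.
  rewrite exchange_big; apply: eq_bigr => i _ /=.
  rewrite /L /R mulr_suml mulr_sumr; apply: eq_bigr => u _.
  rewrite !mulr_sumr; apply: eq_bigr => v _.
  by rewrite !(chiP i).2; ring.
have [i0 chi_i0] : exists i0, @trivial_character C G = chi i0.
  by apply: character_basis_onto chiP dual _ _; split=> // x y; rewrite mulr1.
have chi_nt i : i != i0 -> nontrivial_character (chi i).
  move=> ii0; split=> // e; have := orth i i0; rewrite e chi_i0 orth eqxx.
  by rewrite (negbTE ii0) mulr1 mulr0 => /eqP; rewrite gt_eqF.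
pose B := \sum_(i | i != i0) Ah i * chi i s * (L i * R i).
set N := `|_| ^+ 2; rewrite -/Q.
have Ah0 : Ah i0 = #|A|%:R.
  rewrite /Ah -chi_i0 /fourier /indicator -sum1_card natr_sum [RHS]big_mkcond.
  by apply: eq_bigr => x _; rewrite mulr1; case: ifP.
have QB : n * Q = #|A|%:R * N + B.
  have L0 : L i0 = \sum_u f u by apply: eq_bigr => u _; rewrite -chi_i0 mulr1.
  have R0 : R i0 = (\sum_u f u)^*.
    by rewrite rmorph_sum; apply: eq_bigr => u _; rewrite -chi_i0 mulr1.
  by rewrite QE (bigD1 i0) //= Ah0 -chi_i0 mulr1 L0 R0 -normCK.
have N_ge0 : 0 <= N by rewrite exprn_ge0.
(* Exchanging [u] and [v] conjugates the terms. In the partial order, [B] must be real to be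
   compared with its norm. *)
have Q_real : Q \is Num.real.
  apply/CrealP; rewrite rmorph_sum /Q exchange_big; apply: eq_bigr => u _ /=.
  rewrite rmorph_sum; apply: eq_bigr => v _ /=.
  by rewrite !rmorphM /= conjCK conjC_nat (addrC u) mulrAC.
have B_real : B \is Num.real.
  have -> : B = n * Q - #|A|%:R * N by rewrite QB addrC addKr.
  by apply: realB; apply: realM; rewrite ?realn // ger0_real // ltW.
rewrite -(ler_pM2l n0) mulrBr QB.
apply: (@le_trans _ _ B).
  (* The subtracted square absorbs the trivial character, as [A] has at most as many elements as
     [G]. *)
  rewrite addrAC gerDr subr_le0 ler_wpM2r // ler_nat; exact: max_card.
apply: le_trans (real_ler_norm B_real) _.
apply: le_trans (ler_norm_sum _ _ _) _.
have LR : 2 * (n * (M * F)) = \sum_i M * (`|L i| ^+ 2 + `|R i| ^+ 2).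
  rewrite -mulr_sumr big_split /= !parseval.
  under [X in _ = _ * (_ + _ * X)]eq_bigr do rewrite norm_conjC.
  by rewrite -/F; ring.
(* The index [i0] is restored with a zero term on the left; on the right its term is nonnegative
   because [M] is. *)
rewrite -(@ler_pM2l _ 2) ?ltr0n // LR mulr_sumr big_mkcond /=.
apply: ler_sum => i _.
have M0 := nontrivial_fourier_max_ge0.
case: ifPn => [ii0|_]; last by rewrite mulr_ge0 ?addr_ge0 ?exprn_ge0.
rewrite !normrM (character_norm _ (chiP i)) mulr1 mulrCA.
apply: ler_pM; rewrite ?mulr_ge0 //; first exact: nontrivial_fourier_le (chi_nt i ii0).
rewrite -subr_ge0.
have -> : `|L i| ^+ 2 + `|R i| ^+ 2 - 2 * (`|L i| * `|R i|) = (`|L i| - `|R i|) ^+ 2 by ring.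
by rewrite real_exprn_even_ge0 // realB ?normr_real.
Qed.
End FourierBound.

(** * Insertion of a vertex into a tuple *)

Section TupleInsertion.
Variable T : finType.

Definition insert_vertex m (z : m.-tuple T) (i : 'I_m.+1) (x : T) : m.+1.-tuple T :=
  [tuple if unlift i j is Some l then tnth z l else x | j < m.+1].

Lemma tnth_insert_lift m (z : m.-tuple T) i x j :
  tnth (insert_vertex z i x) (lift i j) = tnth z j.
Proof. by rewrite tnth_mktuple liftK. Qed.

Lemma tnth_insert_same m (z : m.-tuple T) i x : tnth (insert_vertex z i x) i = x.
Proof. by rewrite tnth_mktuple unlift_none. Qed.

Lemma drop_insert m (z : m.-tuple T) i x : drop_vertex (insert_vertex z i x) i = z.
Proof. by apply: eq_from_tnth => j; rewrite tnth_mktuple tnth_insert_lift. Qed.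

Lemma insert_drop m (t : m.+1.-tuple T) i :
  insert_vertex (drop_vertex t i) i (tnth t i) = t.
Proof.
apply: eq_from_tnth => j; case: (unliftP i j) => [l|] ->.
  by rewrite tnth_insert_lift tnth_mktuple.
by rewrite tnth_insert_same.
Qed.

(** The simplicial identity for the faces that contain the new vertex. *)
Lemma drop_insert0_lift m (z : m.+1.-tuple T) x j :
  drop_vertex (insert_vertex z ord0 x) (lift ord0 j)
    = insert_vertex (drop_vertex z j) ord0 x.
Proof.
apply: eq_from_tnth => l; rewrite tnth_mktuple.
case: (unliftP ord0 l) => [h|] ->.
  rewrite [RHS]tnth_insert_lift [RHS]tnth_mktuple.
  have -> : lift (lift ord0 j) (lift ord0 h) = lift ord0 (lift j h).
    by apply: val_inj; rewrite /= /bump /= !add1n ltnS addnS.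
  by rewrite tnth_insert_lift.
have -> : lift (lift ord0 j) ord0 = ord0 by apply: val_inj.
by rewrite !tnth_insert_same.
Qed.

(** The sign of [lift_perm i ord0 r] is that of [r] times (-1)^i, the cost of moving place [i] to
    the front. *)
Lemma insert_vertex_perm m (r : 'S_m) (z : m.-tuple T) i x :
  insert_vertex (perm_tuple r z) i x
    = perm_tuple (lift_perm i ord0 r) (insert_vertex z ord0 x).
Proof.
apply: eq_from_tnth => j; rewrite [RHS]tnth_mktuple.
case: (unliftP i j) => [l|] ->.
  by rewrite lift_perm_lift !tnth_insert_lift tnth_mktuple.
by rewrite lift_perm_id !tnth_insert_same.
Qed.

Lemma sum_insert_vertex (V : nmodType) m (F : m.+1.-tuple T -> V) i :
  \sum_t F t = \sum_z \sum_x F (insert_vertex z i x).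
Proof.
rewrite pair_bigA (reindex (fun p => insert_vertex p.1 i p.2)) //=.
exists (fun t => (drop_vertex t i, tnth t i)) => [[z x]|t] _ /=.
  by rewrite drop_insert tnth_insert_same.
exact: insert_drop.
Qed.

Lemma perm_tuple_inj m (s : 'S_m) : injective (@perm_tuple T m s).
Proof.
move=> t u e; apply: eq_from_tnth => i.
by have /(congr1 (fun v => tnth v (s^-1%g i))) := e; rewrite !tnth_mktuple permKV.
Qed.

Lemma nonuniq_tuple m (t : m.-tuple T) : ~~ uniq t ->
  exists a b, a != b /\ tnth t a = tnth t b.
Proof.
move=> /tuple_uniqP nut; apply: contrapT => nex; apply: nut => a b tab.
by apply/eqP; apply: contra_notT nex => ab; exists a, b.
Qed.

End TupleInsertion.

(** * The adjoint coboundary and the Laplacian, through sums over all ordered tuples *)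

Section CochainLaplacian.
Variables (C : numClosedFieldType) (T : finType) (X : simplicial_complex T).
Local Notation fun_space m := {ffun m.-tuple T -> C^o}.

Lemma cochain_perm m (f : fun_space m) (s : 'S_m) t :
  f \in cochain_space C X m -> f (perm_tuple s t) = (-1) ^+ s * f t.
Proof. by case/cochain_spaceP. Qed.

Lemma cochain_off m (f : fun_space m) t :
  f \in cochain_space C X m -> ~~ ordered_simplex X t -> f t = 0.
Proof. by case/cochain_spaceP=> _; apply. Qed.

Lemma cochain_insert m (f : fun_space m.+1) (z : m.-tuple T) i x :
  f \in cochain_space C X m.+1 ->
  f (insert_vertex z i x) = (-1) ^+ i * f (insert_vertex z ord0 x).
Proof.
move=> fX; have {1}-> : z = perm_tuple 1 z.
  by apply: eq_from_tnth => j; rewrite tnth_mktuple perm1.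
by rewrite insert_vertex_perm (cochain_perm _ _ fX) odd_lift_perm odd_perm1 /=
  !addbF signr_odd.
Qed.

(** This will be the adjoint of the coboundary. The sum may run over all vertices, since a cochain
    vanishes off the ordered simplices. *)
Definition boundary_fun m (f : fun_space m.+1) : fun_space m :=
  [ffun z => \sum_x f (insert_vertex z ord0 x)].

Lemma boundary_fun_mem m (f : fun_space m.+1) :
  f \in cochain_space C X m.+1 -> boundary_fun f \in cochain_space C X m.
Proof.
move=> fX; apply/cochain_spaceP; split=> [s z|z].
  rewrite !ffunE mulr_sumr; apply: eq_bigr => x _.
  by rewrite insert_vertex_perm (cochain_perm _ _ fX) odd_lift_perm /=.
apply: contraNeq; rewrite ffunE => nz.
have [x xX] : exists x, ordered_simplex X (insert_vertex z ord0 x).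
  apply: contrapT => nex; move/negP: nz; apply; apply/eqP/big1 => x _.
  by apply: cochain_off fX _; apply/negP => h; apply: nex; exists x.
move: xX => /andP[/tuple_uniqP ut tX]; apply/andP; split.
  apply/tuple_uniqP => i j e; apply/(@lift_inj _ ord0)/ut.
  by rewrite !tnth_insert_lift.
apply: faces_subset tX _; apply/fintype.subsetP => y; rewrite !inE => /tnthP[i ->].
by apply/tnthP; exists (lift ord0 i); rewrite tnth_insert_lift.
Qed.

(** The [m.+1] faces contribute equally: the sign of a face cancels the sign of reinserting the
    dropped vertex at its place. *)
Lemma pairing_coboundary m (f : fun_space m) (g : fun_space m.+1) :
  g \in cochain_space C X m.+1 ->
  \sum_t coboundary_fun X f t * (g t)^*
    = m.+1%:R * \sum_z f z * (boundary_fun g z)^*.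
Proof.
move=> gX.
transitivity (\sum_t \sum_(i < m.+1) (-1) ^+ i * f (drop_vertex t i) * (g t)^*).
  apply: eq_bigr => t _; rewrite ffunE -mulr_suml; case: ifPn => // tX.
  by rewrite (cochain_off gX tX) conjC0 !mulr0.
rewrite exchange_big /= -[in RHS](card_ord m.+1) -sum1_card natr_sum mulr_suml.
apply: eq_bigr => i _; rewrite mul1r (sum_insert_vertex _ i).
apply: eq_bigr => z _; rewrite ffunE rmorph_sum mulr_sumr.
apply: eq_bigr => x _; rewrite drop_insert (cochain_insert _ _ _ gX).
by rewrite rmorphM rmorph_sign /= mulrACA -expr2 sqrr_sign mul1r.
Qed.

(* A simplex with m vertices has m! orderings, exactly one of which is the
   chosen orientation. *)
Lemma sum_oriented_simplex m (F : m.-tuple T -> C) :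
  (forall s t, F (perm_tuple s t) = F t) ->
  (forall t, ~~ ordered_simplex X t -> F t = 0) ->
  \sum_t F t = m`!%:R * \sum_(t | oriented_simplex X t) F t.
Proof.
move=> Fperm Foff.
have -> : m`!%:R * \sum_(t | oriented_simplex X t) F t
    = \sum_(s : 'S_m) \sum_(t | oriented_simplex X (perm_tuple s t)) F t.
  rewrite -card_Sn -sum1_card natr_sum mulr_suml.
  apply: eq_big => // s _; rewrite mul1r (reindex_inj (@perm_tuple_inj _ _ s)).
  by apply: eq_bigr => t _; apply: Fperm.
rewrite (exchange_big_dep predT) //=; apply: eq_bigr => t _.
have [tX|tX] := boolP (ordered_simplex X t); last first.
  by rewrite Foff // big1 // => s _; rewrite Foff.
have et : size (enum t) == m.
  by rewrite -cardE; case/andP: (tX) => /card_uniqP -> _; rewrite size_tuple.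
pose o := Tuple et; have [ut _] := andP tX.
have orientedE s : oriented_simplex X (perm_tuple s t) = (perm_tuple s t == o).
  rewrite /oriented_simplex ordered_simplex_perm tX -val_eqE /=.
  by congr (_ == _); apply/eq_enum/mem_perm_tuple.
have [s sE] : exists s : 'S_m, o = perm_tuple s t.
  have /tuple_permP[s sE] : perm_eq o t.
    by apply: uniq_perm => //; [exact: enum_uniq | move=> x; rewrite mem_enum].
  by exists s; apply: val_inj.
rewrite (big_pred1 s) // => r; rewrite orientedE sE.
apply/eqP/eqP => [e|->//]; apply/permP => i.
have /(congr1 (fun u => tnth u i)) := e; rewrite !tnth_mktuple.
by move: ut => /tuple_uniqP; apply.
Qed.

Lemma sum_cochain_inner m (f g : cochain C X m) :
  \sum_t vsval f t * (vsval g t)^* = m`!%:R * inner f g.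
Proof.
apply: sum_oriented_simplex => [s t|t tX].
  rewrite !(cochain_perm _ _ (subvsP _)) rmorphM rmorph_sign /=.
  by rewrite mulrACA -expr2 sqrr_sign mul1r.
by rewrite (cochain_off (subvsP f) tX) mul0r.
Qed.

(** The factor [m.+1] of [pairing_coboundary] is the ratio of the numbers of orderings, (m+1)! and
    m!, so it disappears in [inner]. *)
Lemma adjoint_coboundary m (g : cochain C X m.+1) :
  vsval (adjoint (coboundary C X m) g) = boundary_fun (vsval g).
Proof.
pose h : cochain C X m := vsproj _ (boundary_fun (vsval g)).
have hE : vsval h = boundary_fun (vsval g).
  by rewrite vsprojK // boundary_fun_mem // subvsP.
suff -> : adjoint (coboundary C X m) g = h by [].
apply: inner_inj => f; rewrite -adjointP.
have m_neq0 : m.+1`!%:R != 0 :> C by rewrite pnatr_eq0 -lt0n fact_gt0.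
apply: (mulfI m_neq0); rewrite -sum_cochain_inner coboundaryE.
rewrite pairing_coboundary ?subvsP // factS natrM -mulrA -sum_cochain_inner.
by rewrite hE.
Qed.

Lemma inner_laplacian j (f : cochain C X j.+1) :
  j.+1`!%:R * inner (laplacian C X j f) f
    = \sum_z boundary_fun (coboundary_fun X (vsval f)) z * (vsval f z)^*
      + j.+1%:R * \sum_w `|boundary_fun (vsval f) w| ^+ 2.
Proof.
rewrite add_lfunE !comp_lfunE -[X in inner (X + _)]scale1r inner_linearl mul1r.
rewrite mulrDr addrC; congr (_ + _).
  by rewrite -sum_cochain_inner adjoint_coboundary coboundaryE.
rewrite adjointP factS natrM -mulrA -sum_cochain_inner adjoint_coboundary.
by congr (_ * _); apply: eq_bigr => w _; rewrite normCK.
Qed.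

Lemma alternating_sum_perm m (f : fun_space m) (s : 'S_m.+1) t :
  f \in cochain_space C X m ->
  \sum_(i < m.+1) (-1) ^+ i * f (drop_vertex (perm_tuple s t) i)
    = (-1) ^+ s * \sum_(i < m.+1) (-1) ^+ i * f (drop_vertex t i).
Proof.
move=> fX; rewrite mulr_sumr [RHS](reindex_inj (@perm_inj _ s)) /=.
apply: eq_bigr => i _; have [r sE] := lift_perm_factor s i.
rewrite {1}sE drop_vertex_perm (cochain_perm _ _ fX) sE odd_lift_perm.
rewrite lift_perm_id !mulrA; congr (_ * _).
rewrite !signr_addb (signr_odd _ i) (signr_odd _ (s i)).
by rewrite [RHS]mulrAC -(mulrA ((-1) ^+ i)) -expr2 sqrr_sign mulr1.
Qed.

(** Swapping two equal entries fixes [t] and changes the sign of the sum. *)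
Lemma alternating_sum_nonuniq m (f : fun_space m) (t : m.+1.-tuple T) :
  f \in cochain_space C X m -> ~~ uniq t ->
  \sum_(i < m.+1) (-1) ^+ i * f (drop_vertex t i) = 0.
Proof.
move=> fX nut.
have [a [b [ab tab]]] := nonuniq_tuple nut.
have tE : perm_tuple (tperm a b) t = t.
  apply: eq_from_tnth => i; rewrite tnth_mktuple.
  by case: tpermP => [->|->|].
have := alternating_sum_perm (tperm a b) t fX.
rewrite tE odd_tperm ab expr1 mulN1r => /eqP.
by rewrite -addr_eq0 -mulr2n mulrn_eq0 /= => /eqP.
Qed.

Lemma cochain_space_neq0 m : (m <= #|T|)%N ->
  (forall t : m.-tuple T, uniq t -> ordered_simplex X t) ->
  (0 < \dim {: cochain C X m})%N.
Proof.
move=> mT simplicial.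
have s_size : size (take m (enum T)) == m by rewrite size_takel // -cardE.
pose o := Tuple s_size; have o_uniq : uniq o by rewrite take_uniq ?enum_uniq.
(* The witness is the alternating cochain dual to [o]: the determinant is the sign of the
   permutation if [t] reorders [o], and 0 otherwise. *)
pose M (t : m.-tuple T) : 'M[C]_m := \matrix_(i, j) (tnth t i == tnth o j)%:R.
pose f : fun_space m := [ffun t => \det (M t)].
have fX : f \in cochain_space C X m.
  apply/cochain_spaceP; split=> [s t|t tX]; rewrite !ffunE.
    have -> : M (perm_tuple s t) = row_perm s (M t).
      by apply/matrixP=> i j; rewrite !mxE tnth_mktuple.
    by rewrite row_permE det_mulmx det_perm.
  have nut : ~~ uniq t by apply: contra tX; apply: simplicial.
  have [a [b [ab tab]]] := nonuniq_tuple nut.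
  by apply: (determinant_alternate ab) => j; rewrite !mxE tab.
have fo : f o = 1.
  rewrite ffunE; have -> : M o = 1%:M; last exact: det1.
  have /tuple_uniqP o_inj := o_uniq.
  by apply/matrixP=> i j; rewrite !mxE (inj_eq o_inj).
rewrite lt0n dimv_eq0; apply/eqP => e.
have : vsproj (cochain_space C X m) f \in fullv by apply: memvf.
rewrite e memv0 => /eqP /(congr1 vsval); rewrite vsprojK // => f0.
by move/eqP: fo; rewrite f0 ffunE eq_sym oner_eq0.
Qed.

End CochainLaplacian.

(** * Positivity of the Laplacian and existence of its least eigenvalue *)

Section LaplacianSpectrum.
Variables (C : numClosedFieldType) (T : finType) (X : simplicial_complex T).

Lemma inner_ge0 m (f : cochain C X m) : 0 <= inner f f.
Proof. by apply: sumr_ge0 => t _; rewrite mul_conjC_ge0. Qed.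

Lemma inner_gt0 m (f : cochain C X m) : f != 0 -> 0 < inner f f.
Proof.
move=> f0; rewrite lt0r inner_ge0 andbT.
by apply: contra_neq f0; apply: inner_eq0.
Qed.

Lemma inner_laplacian_ge0 j (f : cochain C X j.+1) :
  0 <= inner (laplacian C X j f) f.
Proof.
rewrite add_lfunE !comp_lfunE -[X in inner (X + _)]scale1r inner_linearl mul1r.
apply: addr_ge0; first by rewrite adjointP inner_ge0.
by rewrite -inner_conj -adjointP inner_conj inner_ge0.
Qed.

Lemma eigenvector_laplacian j a : passmx.leigenvalue (laplacian C X j) a ->
  exists2 f, f != 0 & laplacian C X j f = a *: f.
Proof.
rewrite /passmx.leigenvalue; move: (laplacian C X j) => L f0.
exists (vpick (passmx.leigenspace L a)); first by rewrite vpick0.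
have := memv_pick (passmx.leigenspace L a); rewrite memv_ker.
by rewrite add_lfunE opp_lfunE scale_lfunE id_lfunE subr_eq0 => /eqP.
Qed.

Lemma eigenvalue_laplacian_ge0 j a :
  passmx.leigenvalue (laplacian C X j) a -> 0 <= a.
Proof.
case/eigenvector_laplacian=> f f0 Lf.
have := inner_laplacian_ge0 f; rewrite Lf -[_ *: f]addr0 inner_linearl.
have -> : inner 0 f = 0 by rewrite /inner big1 // => t _; rewrite ffunE mul0r.
by rewrite addr0 pmulr_lge0 // inner_gt0.
Qed.

(** The eigenvalues are the roots of a characteristic polynomial, so finitely many and at least one;
    positivity makes them real. Hence the minimum is attained. *)
Lemma min_eigenvalue_laplacianP j : (0 < \dim {: cochain C X j.+1})%N ->
  passmx.leigenvalue (laplacian C X j) (min_eigenvalue_laplacian C X j).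
Proof.
move=> dim_gt0; set L := laplacian C X j.
set e := vbasis {: cochain C X j.+1}.
have eP : basis_of {: cochain C X j.+1} e := vbasisP _.
have LE a : passmx.leigenvalue L a = eigenvalue (passmx.mxof e e L) a.
  by rewrite /passmx.leigenvalue (passmx.leigenspaceE eP) passmx.vsof_eq0.
have [r rE] := closed_field_poly_normal (char_poly (passmx.mxof e e L)).
apply: (@minimum_mem C (fun a => passmx.leigenvalue L a) r).
- have [a aL] := eigenvalue_closed (passmx.mxof e e L) dim_gt0.
  by exists a; rewrite /= LE.
- move=> a; rewrite /= LE eigenvalue_root_char rE.
  rewrite (monicP (char_poly_monic _)) scale1r root_prod_XsubC //.
- by move=> a /eigenvalue_laplacian_ge0; apply: ger0_real.
Qed.

End LaplacianSpectrum.

(** * The Laplacian of a sum complex and its eigenvalues *)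

Section SumComplexLaplacian.
Variables (C : numClosedFieldType) (G : finZmodType) (A : {set G}) (k : nat).
(** The k of the theorem is [k.+1] here, which is also the number of vertices of the simplices that
    carry the eigencochain. *)
Let X := sum_complex A k.+1.
Local Notation fun_space m := {ffun m.-tuple G -> C^o}.

Definition vertex_sum m (t : m.-tuple G) : G := \sum_i tnth t i.

Lemma vertex_sum_insert m (z : m.-tuple G) i x :
  vertex_sum (insert_vertex z i x) = x + vertex_sum z.
Proof.
rewrite /vertex_sum (bigD1_ord i) //= tnth_insert_same; congr (_ + _).
by apply: eq_bigr => l _; rewrite tnth_insert_lift.
Qed.

Lemma card_tuple_set m (t : m.-tuple G) : uniq t -> #|[set x in t]| = m.
Proof. by move=> ut; rewrite cardsE (card_uniqP ut) size_tuple. Qed.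

Lemma sum_complex_small m (t : m.-tuple G) : (m <= k.+1)%N -> uniq t ->
  ordered_simplex X t.
Proof. by move=> mk ut; rewrite /ordered_simplex ut inE card_tuple_set ?mk. Qed.

Lemma sum_complex_top (t : k.+2.-tuple G) : uniq t ->
  ordered_simplex X t = (vertex_sum t \in A).
Proof.
move=> ut; rewrite /ordered_simplex ut inE card_tuple_set // ltnn eqxx /=.
congr (_ \in A); rewrite /vertex_sum -(big_tuple _ _ t xpredT id) big_uniq //=.
by apply: eq_bigl => x; rewrite inE.
Qed.

(** On tuples with repetitions the alternating sum vanishes, so the indicator alone encodes
    membership in the complex. Sums over vertices can then run over the whole group. *)
Lemma coboundary_sum_complex (f : fun_space k.+1) t :
  f \in cochain_space C X k.+1 ->
  coboundary_fun X f t = indicator C A (vertex_sum t)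
    * \sum_(i < k.+2) (-1) ^+ i * f (drop_vertex t i).
Proof.
move=> fX; rewrite ffunE; have [ut|nut] := boolP (uniq t).
  by rewrite sum_complex_top // /indicator; case: ifP; rewrite ?mul1r ?mul0r.
by rewrite (alternating_sum_nonuniq fX nut) mulr0 if_same.
Qed.

Lemma sum_indicator_shift y : \sum_(x : G) indicator C A (x + y) = #|A|%:R.
Proof.
under eq_bigr do rewrite addrC.
rewrite (sum_shift (indicator C A) y) -sum1_card natr_sum [RHS]big_mkcond.
by apply: eq_bigr => x _; rewrite /indicator; case: ifP.
Qed.

(** This is Q_w, the form of [translate_form_le] with [vertex_sum w] for [s]. *)
Definition link_form (f : fun_space k.+1) (w : k.-tuple G) : C :=
  \sum_u \sum_v indicator C A (u + v + vertex_sum w)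
    * f (insert_vertex w ord0 u) * (f (insert_vertex w ord0 v))^*.

(** The face opposite to the new vertex gives the first term, as exactly |A| choices of that vertex
    bring the vertex sum into [A]. Each of the other [k.+1] faces gives one copy of the link
    forms. *)
Lemma up_laplacian_sum_complex (f : fun_space k.+1) :
  f \in cochain_space C X k.+1 ->
  \sum_z boundary_fun (coboundary_fun X f) z * (f z)^*
    = #|A|%:R * \sum_z `|f z| ^+ 2 - k.+1%:R * \sum_w link_form f w.
Proof.
move=> fX.
pose J x (z : k.+1.-tuple G) := indicator C A (x + vertex_sum z).
pose E (j : 'I_k.+1) (z : k.+1.-tuple G) :=
  \sum_x J x z * ((-1) ^+ j * f (insert_vertex (drop_vertex z j) ord0 x)).
have dE z : boundary_fun (coboundary_fun X f) z = #|A|%:R * f z - \sum_(j < k.+1) E j z.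
  rewrite ffunE -(sum_indicator_shift (vertex_sum z)) mulr_suml exchange_big -sumrB.
  apply: eq_bigr => x _ /=; rewrite coboundary_sum_complex // vertex_sum_insert.
  rewrite -mulr_sumr -mulrBr big_ord_recl expr0 mul1r drop_insert -sumrN.
  congr (_ * (_ + _)); apply: eq_bigr => j _.
  by rewrite drop_insert0_lift exprS mulN1r mulNr.
under eq_bigr => z _ do rewrite dE mulrBl -mulrA -normCK mulr_suml.
rewrite sumrB mulr_sumr; congr (_ - _).
rewrite exchange_big /= -[in RHS](card_ord k.+1) -sum1_card natr_sum mulr_suml.
(* Here [z] splits into its entry [v] at place [j] and the rest [w]; the sign of the face cancels
   that of moving [v] to the front. *)
apply: eq_bigr => j _; rewrite mul1r (sum_insert_vertex _ j).
apply: eq_bigr => w _; rewrite /link_form exchange_big; apply: eq_bigr => v _ /=.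
rewrite /E mulr_suml; apply: eq_bigr => u _.
rewrite /J vertex_sum_insert drop_insert (cochain_insert w j v fX) rmorphM rmorph_sign /=.
rewrite addrA -!mulrA; congr (_ * _).
by rewrite mulrCA signrMK.
Qed.

Lemma eigenvalue_sum_complex_ge a : (1 < #|G|)%N ->
  passmx.leigenvalue (laplacian C X k) a ->
  #|A|%:R - k.+1%:R * maximum (@nontrivial_spectrum C G A) <= a.
Proof.
move=> G_gt1 /eigenvector_laplacian[phi phi0 Lphi]; pose f := vsval phi.
have fX : f \in cochain_space C X k.+1 := subvsP phi.
set M := maximum _; pose S := \sum_z `|f z| ^+ 2.
have SE : S = k.+1`!%:R * inner phi phi.
  by rewrite -sum_cochain_inner; apply: eq_bigr => z _; rewrite normCK.
have S_gt0 : 0 < S by rewrite SE mulr_gt0 ?inner_gt0 // ltr0n fact_gt0.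
(* The square from the lower part of the Laplacian is grouped with the link form, to match the left
   side of [translate_form_le]. *)
have aS : a * S = #|A|%:R * S
    - k.+1%:R * \sum_w (link_form f w - `|boundary_fun f w| ^+ 2).
  have := inner_laplacian phi; rewrite Lphi -[_ *: phi]addr0 inner_linearl.
  have -> : inner 0 phi = 0 by rewrite /inner big1 // => t _; rewrite ffunE mul0r.
  rewrite addr0 mulrCA -SE => ->; rewrite up_laplacian_sum_complex // sumrB.
  by rewrite -/S mulrBr opprB addrA addrAC.
rewrite -(ler_pM2r S_gt0) aS mulrBl lerD2l lerN2 -mulrA ler_pM2l ?ltr0n //.
rewrite /S (sum_insert_vertex _ ord0) mulr_sumr; apply: ler_sum => w _.
rewrite ffunE; exact: translate_form_le.
Qed.

End SumComplexLaplacian.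

Theorem theorem3p1 (R : realType) (G : finZmodType) (A : {set G}) (n k : nat)
    (hn : #|G| = n) (hk : (1 <= k < n)%N) :
  #|A|%:R
    - k%:R * maximum [set `|fourier (indicator R[i] A) eta|
                     | eta in @nontrivial_character R[i] G]%classic
  <= min_eigenvalue_laplacian R[i] (sum_complex A k) k.-1.
Proof.
case: k hk => // k /=; rewrite -hn => kG.
apply: eigenvalue_sum_complex_ge; first exact: leq_ltn_trans kG.
(* As k is at most the order of [G], nonzero cochains exist and the minimum is a genuine
   eigenvalue. *)
apply: min_eigenvalue_laplacianP; apply: cochain_space_neq0; first exact: ltnW.
by move=> t; apply: sum_complex_small.
Qed.
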